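(* Let $K$ be a field of characteristic zero, $R=K[x,y,z]$ with the standard grading, and let $a,b,c,\beta,\gamma$ be integers with $a\geq c\geq 2$, $1\leq \beta\leq b-1$ and $\max\{1,b-a+1\}\leq \gamma\leq \min\{b-1,c-1\}$. Consider the ideal $$I=(x^a,\ y^b-x^{b-\gamma}z^\gamma,\ z^c,\ x^{a-b+\gamma}y^{b-\beta},\ y^{b-\beta}z^{c-\gamma})\subset R.$$ If one of $a,b,c$ is equal to five, then $R/I$ has the weak Lefschetz property.
   Context: A graded Artinian $K$-algebra $A=\bigoplus_i [A]_i$ has the weak Lefschetz property (WLP) if there exists a linear form $L\in[A]_1$ such that the multiplication map $\times L:[A]_i\to[A]_{i+1}$ has maximal rank (i.e. is injective or surjective) for every $i$. *)

(* Defs.v *)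
From HB Require Import structures.
From mathcomp Require Import all_boot all_order all_algebra.
From mathcomp Require Import mpoly.
Set Implicit Arguments. Unset Strict Implicit. Unset Printing Implicit Defensive.
Import GRing.Theory.
Local Open Scope ring_scope.

(* p is homogeneous of (standard) degree d: every monomial in its support
   has total degree d.  (0 is homogeneous of every degree.) *)
Definition homogeneous (n : nat) (K : fieldType) (d : nat) (p : {mpoly K[n]}) : Prop :=
  forall m, m \in msupp p -> mdeg m = d.

Definition in_ideal (n k : nat) (K : fieldType) (g : 'I_k -> {mpoly K[n]})
    (f : {mpoly K[n]}) : Prop :=
  exists h : 'I_k -> {mpoly K[n]}, f = \sum_(j < k) h j * g j.

(* The multiplication map  x L : [R/I]_i -> [R/I]_(i+1),  where
   [R/I]_i = R_i / I_i, is injective *)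
Definition mulL_injective (n k : nat) (K : fieldType) (g : 'I_k -> {mpoly K[n]})
    (L : {mpoly K[n]}) (i : nat) : Prop :=
  forall f, homogeneous i f -> in_ideal g (L * f) -> in_ideal g f.

Definition mulL_surjective (n k : nat) (K : fieldType) (g : 'I_k -> {mpoly K[n]})
    (L : {mpoly K[n]}) (i : nat) : Prop :=
  forall f, homogeneous i.+1 f ->
    exists2 f0, homogeneous i f0 & in_ideal g (f - L * f0).

Definition has_WLP (n k : nat) (K : fieldType) (g : 'I_k -> {mpoly K[n]}) : Prop :=
  exists2 L : {mpoly K[n]}, homogeneous 1 L &
    forall i : nat, mulL_injective g L i \/ mulL_surjective g L i.

Definition vx (K : fieldType) : {mpoly K[3]} := 'X_(inord 0).
Definition vy (K : fieldType) : {mpoly K[3]} := 'X_(inord 1).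
Definition vz (K : fieldType) : {mpoly K[3]} := 'X_(inord 2).

Definition gensI (K : fieldType) (a b c beta gamma : nat) : 'I_5 -> {mpoly K[3]} :=
  fun j => nth 0
    [:: vx K ^+ a;
        vy K ^+ b - vx K ^+ (b - gamma) * vz K ^+ gamma;
        vz K ^+ c;
        vx K ^+ (a + gamma - b) * vy K ^+ (b - beta);
        vy K ^+ (b - beta) * vz K ^+ (c - gamma)] j.

(* Main.v *)
(* Put u = b - gamma, v = gamma, d = b - beta and e = a + c + d - 3.  The
   algebra A = R/I is Gorenstein of socle degree e, with dual socle generator
   the sum of the monomials x^(a-1-ku) y^(d-1+kb) z^(c-1-kv), so by duality the
   WLP follows once some L maps [A]_N onto [A]_(N+1) for N = floor(e/2).
   Replacing y^b = x^u z^v by y^b = 0 degenerates A to an extension of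
   K[x,y,z]/(x^a,y^d,z^c) by y^d K[x,y,z]/(x^(a-u),y^(b-d),z^(c-v)).  Both are
   monomial complete intersections whose Hilbert functions are symmetric about
   e/2, and the sl_2-action shows that x + y + z is surjective on each of them
   past the middle degree.  The degeneration is the limit lam -> infinity of A
   with L = lam x + y + lam z, so surjectivity holds for all but finitely many
   lam^b. *)
Require Import Defs.
From HB Require Import structures.
From mathcomp Require Import all_boot all_order all_algebra.
From mathcomp Require Import mpoly zify ring.
Set Implicit Arguments. Unset Strict Implicit. Unset Printing Implicit Defensive.
Import GRing.Theory.
Local Open Scope ring_scope.

(** * Polynomials supported on a set of monomials *)

Section MonoIdeal.
Variables (n : nat) (K : fieldType) (U : pred 'X_{1..n}).

(** [U] may be any set of monomials. For [normal] below it is the complement of a monomial ideal, so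
    this is only a condition on the support. *)
Definition in_mono_ideal (f : {mpoly K[n]}) := forall m, m \in msupp f -> U m.

Lemma in_mono_ideal0 : in_mono_ideal 0.
Proof. by move=> m; rewrite msupp0. Qed.

Lemma in_mono_idealD f g : in_mono_ideal f -> in_mono_ideal g -> in_mono_ideal (f + g).
Proof. by move=> Uf Ug m /msuppD_le; rewrite mem_cat => /orP[/Uf|/Ug]. Qed.

Lemma in_mono_idealZ k f : in_mono_ideal f -> in_mono_ideal (k *: f).
Proof. by move=> Uf m /msuppZ_le/Uf. Qed.

Lemma in_mono_idealX m : U m -> in_mono_ideal 'X_[m].
Proof. by move=> Um m'; rewrite msuppX inE => /eqP ->. Qed.

End MonoIdeal.

(** * The sl_2-action on monomial complete intersections *)

Section MonomialCI.
Variables (n : nat) (K : fieldType) (al : 'I_n -> nat).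
Hypothesis char0 : [pchar K] =i pred0.
Hypothesis al_gt0 : forall v, (0 < al v)%N.

Let Lsum : {mpoly K[n]} := \sum_v 'X_v.
Let soc : nat := (\sum_v (al v).-1)%N.

Definition ci_mono : pred 'X_{1..n} := fun m => [exists v, al v <= m v]%N.

(* The sl_2-lowering operator: a power x_v^i is sent to i (al_v - i) x_v^(i-1),
   so that the ideal generated by the x_v^(al_v) is preserved. *)
Definition lower (f : {mpoly K[n]}) : {mpoly K[n]} :=
  \sum_v ((al v)%:R *: f^`M(v) - ('X_v * f^`M(v))^`M(v)).

Lemma mcoeff_lower f m :
  (lower f)@_m = \sum_v (m v).+1%:R * ((al v)%:R - (m v).+1%:R) * f@_(m + U_(v)).
Proof.
rewrite /lower raddf_sum /=; apply: eq_bigr => v _.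
rewrite mcoeffB mcoeffZ !mcoeff_mderiv [_ * f^`M(v)]mulrC.
rewrite [X in (_ * _)@_X]addmC mcoeffMX mcoeff_mderiv.
by rewrite -mulrA mulrBl !mulr_natl mulrnBl [X in X - _]mulrnAC.
Qed.

Lemma lower_dhomog d f : f \is d.+1.-homog -> lower f \is d.-homog.
Proof.
move=> /dhomogP hf; apply/dhomogP => m; rewrite mcoeff_msupp mcoeff_lower.
move=> /eqP nz; have [v nzv|z] := pickP (fun v => f@_(m + U_(v)) != 0).
  by move: (hf (m + U_(v))%MM); rewrite mcoeff_msupp /= mdegD mdeg1 => /(_ nzv); lia.
by case: nz; apply: big1 => v _; move/negbFE/eqP: (z v) => ->; rewrite mulr0.
Qed.

(** A term passing from the ideal to a monomial outside it must lower some x_v^(al_v) to x_v^(al_v -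
    1), and there the factor al_v - (m_v + 1) of [mcoeff_lower] vanishes. *)
Lemma lower_ci f : in_mono_ideal ci_mono f -> in_mono_ideal ci_mono (lower f).
Proof.
move=> Uf m; rewrite mcoeff_msupp mcoeff_lower /ci_mono; apply: contraNT => /existsPn Um.
apply/eqP; apply: big1 => v _.
have [->|nz] := eqVneq (f@_(m + U_(v))) 0; first by rewrite mulr0.
have /Uf/existsP[w] : (m + U_(v))%MM \in msupp f by rewrite mcoeff_msupp.
rewrite mnmDE mnm1E => hw; have := Um w; rewrite -ltnNge => lt.
have vw : v = w by apply/eqP; move: hw lt; case: eqP => //= _; lia.
subst w; have -> : al v = (m v).+1 by move: hw lt; rewrite eqxx /=; lia.
by rewrite subrr mulr0 mul0r.
Qed.

Lemma euler d (f : {mpoly K[n]}) : f \is d.-homog -> \sum_v 'X_v * f^`M(v) = d%:R *: f.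
Proof.
move=> hf; rewrite (mpolyE f).
under eq_bigr => v _ do rewrite raddf_sum mulr_sumr.
rewrite exchange_big scaler_sumr /=; apply: eq_big_seq => m ms.
rewrite scalerA mulrC -scalerA -(dhomog_mf hf ms) /= mdegE natr_sum scaler_suml scaler_sumr.
apply: eq_bigr => v _; rewrite mderivZ -scalerAr mderivX -scalerAr.
case: (posnP (m v)) => [->|mv]; first by rewrite !scale0r.
rewrite -mpolyXD; congr (_ *: (_ *: 'X_[_])); apply/mnmP => w.
rewrite mnmDE mnmBE mnm1E; case: eqP => [<-|_] //=; lia.
Qed.

Lemma Lsum_dhomog : Lsum \is 1.-homog.
Proof. by apply: rpred_sum => v _; rewrite dhomogX /= mdeg1. Qed.

Lemma LsumX_dhomog k : Lsum ^+ k \is k.-homog.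
Proof. by have := dhomogMn k Lsum_dhomog; rewrite mul1n. Qed.

Lemma mderiv_Lsum v : Lsum^`M(v) = 1.
Proof.
rewrite /Lsum raddf_sum /= (bigD1 v) //= big1 => [|w wv]; rewrite mderivX mnm1E.
  rewrite addr0 eqxx scale1r -mpolyX0; congr 'X_[_]; apply/mnmP => w.
  by rewrite mnmBE subnn mnm0E.
by rewrite (negbTE wv) scale0r.
Qed.

(** The sl_2 commutator relation, with degree d of weight soc - 2d. Writing f_v for the partial
    derivative, the variable x_v contributes (al_v - 1) f - 2 x_v f_v, and [euler] adds up the last
    terms. *)
Lemma lower_raise d f : f \is d.-homog ->
  lower (Lsum * f) = Lsum * lower f + (soc%:R - d%:R *+ 2) *: f.
Proof.
move=> hf; rewrite scalerBl mulr2n scalerDl -(euler hf).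
rewrite /soc natr_sum scaler_suml -big_split /lower mulr_sumr -sumrB -big_split /=.
apply: eq_bigr => v _.
rewrite !(mderivM, mderiv_Lsum, mderivD) mderivX mnm1E eqxx scale1r.
have -> : (U_(v) - U_(v))%MM = 0%MM :> 'X_{1..n} by apply/mnmP => w; rewrite mnmBE subnn mnm0E.
rewrite mpolyX0 -!mul_mpolyC.
have -> : (al v)%:R = ((al v).-1)%:R + 1 :> K by rewrite -{1}(prednK (al_gt0 v)) -natr1.
by rewrite mpolyCD mpolyC1 -mpolyC1 mderivC mpolyC1; ring.
Qed.

(** The weights soc - 2(d + j) met for 0 <= j <= k add up to the scalar (k + 1)(soc - 2d - k). *)
Lemma lower_raiseX d k f : f \is d.-homog ->
  lower (Lsum ^+ k.+1 * f) = Lsum ^+ k.+1 * lower f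
    + (k.+1%:R * (soc%:R - d%:R *+ 2 - k%:R)) *: (Lsum ^+ k * f).
Proof.
move=> hf; elim: k => [|k IH].
  by rewrite !expr1 (lower_raise hf) expr0 subr0 !mul1r.
rewrite exprS -mulrA (@lower_raise (k.+1 + d)); last first.
  exact: dhomogM (LsumX_dhomog _) hf.
rewrite IH mulrDr !mulrA -exprS -addrA; congr (_ + _).
rewrite -scalerAr mulrA -exprS -scalerDl; congr (_ *: _).
by rewrite natrD -[k.+2]addn1 natrD -[k.+1]addn1 natrD; ring.
Qed.

(* By the sl_2 relations, L^k w = lower (L^(k+1) f) for the element w below,
   so that w = L * lower f up to a nonzero multiple of f is closer to being
   killed by a power of L. *)
Lemma ci_surj_nilp k d f : (soc < d.+1.*2)%N -> f \is d.+1.-homog ->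
  in_mono_ideal ci_mono (Lsum ^+ k * f) ->
  exists q g, [/\ q \is d.+1.-homog, g \is d.-homog,
    in_mono_ideal ci_mono q & f = q + Lsum * g].
Proof.
move=> hd; elim: k f => [|k IH] f hf hk.
  exists f, 0; split; rewrite ?rpred0 ?mulr0 ?addr0 //.
  by move: hk; rewrite expr0 mul1r.
(* Minus the scalar of [lower_raiseX] in degree d + 1. By [hd] the subtraction is genuine and [c] is
   the image of a positive integer. *)
pose c : K := (k.+1 * (d.+1.*2 + k - soc))%:R.
have c0 : c != 0.
  by rewrite /c; have /pcharf0P -> := char0; rewrite muln_eq0; lia.
have hl : Lsum * lower f \is d.+1.-homog.
  by rewrite -add1n; apply: dhomogM; [apply: Lsum_dhomog | apply: lower_dhomog].
have [||q [g [hq hg Uq e]]] := IH (Lsum * lower f - c *: f).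
- by rewrite rpredB ?rpredZ.
- suff -> : Lsum ^+ k * (Lsum * lower f - c *: f) = lower (Lsum ^+ k.+1 * f).
    exact: lower_ci.
  rewrite (lower_raiseX k hf) mulrBr mulrA -exprSr; congr (_ + _).
  rewrite -scalerAr -scaleNr; congr (_ *: _).
  rewrite /c natrM natrB; last lia.
  by rewrite -addnn !natrD; ring.
exists (- c^-1 *: q), (c^-1 *: (lower f - g)); split.
- exact: rpredZ.
- by rewrite rpredZ // rpredB // lower_dhomog.
- exact: in_mono_idealZ.
apply: (scalerI c0); rewrite scalerDr scalerA mulrN divff // -scalerAr scalerA divff //.
have -> : c *: f = Lsum * lower f - (Lsum * lower f - c *: f) by ring.
by rewrite [in LHS]e scaleN1r scale1r; ring.
Qed.

(** The power soc + 1 of the linear form pushes f above degree soc, where every monomial lies in the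
    ideal, so [ci_surj_nilp] applies. *)
Lemma ci_surj d f : (soc < d.+1.*2)%N -> f \is d.+1.-homog ->
  exists q g, [/\ q \is d.+1.-homog, g \is d.-homog,
    in_mono_ideal ci_mono q & f = q + Lsum * g].
Proof.
move=> hd hf; apply: (@ci_surj_nilp soc.+1) => // m ms.
have hm : Lsum ^+ soc.+1 * f \is (soc.+1 + d.+1).-homog.
  exact: dhomogM (LsumX_dhomog _) hf.
have := dhomog_mf hm ms; rewrite /= mdegE => em.
rewrite /ci_mono; apply: contraPT em => /existsPn Um; apply/eqP.
suff : (\sum_v m v <= soc)%N by lia.
apply: leq_sum => v _; have := Um v; have := al_gt0 v; lia.
Qed.

End MonomialCI.

(** * Ideals, and the image of multiplication by L modulo an ideal *)

Section Ideal.
Variables (n k : nat) (K : fieldType) (g : 'I_k -> {mpoly K[n]}).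

Lemma in_ideal0 : in_ideal g 0.
Proof. by exists (fun=> 0); rewrite big1 // => j _; rewrite mul0r. Qed.

Lemma in_idealD f1 f2 : in_ideal g f1 -> in_ideal g f2 -> in_ideal g (f1 + f2).
Proof.
move=> [h1 ->] [h2 ->]; exists (fun j => h1 j + h2 j).
by rewrite -big_split; apply: eq_bigr => j _; rewrite mulrDl.
Qed.

Lemma in_idealM h f : in_ideal g f -> in_ideal g (h * f).
Proof.
move=> [h1 ->]; exists (fun j => h * h1 j).
by rewrite mulr_sumr; apply: eq_bigr => j _; rewrite mulrA.
Qed.

Lemma in_idealZ c f : in_ideal g f -> in_ideal g (c *: f).
Proof. by rewrite -mul_mpolyC; apply: in_idealM. Qed.

Lemma in_idealB f1 f2 : in_ideal g f1 -> in_ideal g f2 -> in_ideal g (f1 - f2).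
Proof. by move=> h1 h2; rewrite -scaleN1r; apply: in_idealD h1 (in_idealZ _ h2). Qed.

Lemma in_ideal_gen j : in_ideal g (g j).
Proof.
exists (fun i => (i == j)%:R); rewrite (bigD1 j) //= eqxx mul1r big1 ?addr0 //.
by move=> i /negbTE ->; rewrite mul0r.
Qed.

Lemma in_ideal_sum (I : eqType) (r : seq I) (F : I -> {mpoly K[n]}) :
  (forall i, i \in r -> in_ideal g (F i)) -> in_ideal g (\sum_(i <- r) F i).
Proof.
move=> h; rewrite big_seq; apply: big_ind => //; [exact: in_ideal0 | exact: in_idealD].
Qed.

(** Says that the class of f lies in the image of [A]_d under multiplication by L. This is linear in
    f, so surjectivity can be tested on monomials. *)
Definition in_ideal_plus (L : {mpoly K[n]}) d f :=
  exists2 h, h \is d.-homog & in_ideal g (f - L * h).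

Lemma in_ideal_plus_ideal L d f : in_ideal g f -> in_ideal_plus L d f.
Proof. by move=> If; exists 0; rewrite ?rpred0 // mulr0 subr0. Qed.

Lemma in_ideal_plus_mul L d h : h \is d.-homog -> in_ideal_plus L d (L * h).
Proof. by move=> hh; exists h => //; rewrite subrr; apply: in_ideal0. Qed.

Lemma in_ideal_plusD L d f1 f2 :
  in_ideal_plus L d f1 -> in_ideal_plus L d f2 -> in_ideal_plus L d (f1 + f2).
Proof.
move=> [h1 hh1 i1] [h2 hh2 i2]; exists (h1 + h2); first exact: rpredD.
have -> : f1 + f2 - L * (h1 + h2) = (f1 - L * h1) + (f2 - L * h2) by ring.
exact: in_idealD.
Qed.

Lemma in_ideal_plusM L d e w f : w \is e.-homog ->
  in_ideal_plus L d f -> in_ideal_plus L (e + d) (w * f).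
Proof.
move=> hw [h hh i]; exists (w * h); first exact: dhomogM.
have -> : w * f - L * (w * h) = w * (f - L * h) by ring.
exact: in_idealM.
Qed.

Lemma in_ideal_plusZ L d c f : in_ideal_plus L d f -> in_ideal_plus L d (c *: f).
Proof.
rewrite -mul_mpolyC; apply: (@in_ideal_plusM _ _ 0).
by rewrite -[_%:MP]mulr1 mul_mpolyC rpredZ // dhomog1.
Qed.

Lemma in_ideal_plus_sum L d (I : eqType) (r : seq I) (F : I -> {mpoly K[n]}) :
  (forall i, i \in r -> in_ideal_plus L d (F i)) ->
  in_ideal_plus L d (\sum_(i <- r) F i).
Proof.
move=> h; rewrite big_seq; apply: big_ind => //.
- exact/in_ideal_plus_ideal/in_ideal0.
- exact: in_ideal_plusD.
Qed.

(** A monomial of higher degree is a variable times one of degree one less, so surjectivity in one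
    degree propagates upward. *)
Lemma in_ideal_plus_above L N :
  (forall m, mdeg m = N.+1 -> in_ideal_plus L N 'X_[m]) ->
  forall j m, mdeg m = (j + N).+1 -> in_ideal_plus L (j + N) 'X_[m].
Proof.
move=> h; elim=> [|j IH] // m hm.
have [w mw] : exists w, (0 < m w)%N.
  apply/existsP; apply: contraPT hm => /existsPn m0.
  by rewrite mdegE big1 // => w _; have := m0 w; lia.
have le : (U_(w) <= m)%MM.
  by apply/mnm_lepP => w'; rewrite mnm1E; case: eqP => [<-|].
have E : m = ((m - U_(w)) + U_(w))%MM by rewrite submK.
rewrite E addmC mpolyXD -[j.+1]add1n -addnA; apply: in_ideal_plusM.
  by rewrite dhomogX /= mdeg1.
by apply: IH; move: hm; rewrite E mdegD mdeg1 -E; lia.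
Qed.

End Ideal.

(** * Avoiding eigenvalues in a perturbed spanning set *)

Lemma nat_power_nonroot (K : fieldType) (p : {poly K}) b :
  [pchar K] =i pred0 -> p != 0 -> (0 < b)%N ->
  exists2 k, (0 < k)%N & ~~ root p ((k ^ b)%:R).
Proof.
(* In characteristic zero these powers are pairwise distinct, and there are [size p] of them, too
   many for all to be roots. *)
move=> /pcharf0P char0 p0 b0; pose rs := [seq (k.+1 ^ b)%:R : K | k <- iota 0 (size p)].
have [al|/allPn[_ /mapP[k _ ->] nr]] := boolP (all (root p) rs); last by exists k.+1.
suff /(max_poly_roots p0 al) : uniq rs by rewrite size_map size_iota ltnn.
rewrite map_inj_uniq ?iota_uniq // => i j /eqP.
wlog le : i j / (i <= j)%N.
  by move=> H; case: (leqP i j) => [/H //|/ltnW /H]; rewrite eq_sym => E /E.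
have lep : (i.+1 ^ b <= j.+1 ^ b)%N by rewrite leq_exp2r.
rewrite eq_sym -subr_eq0 -natrB // char0 subn_eq0 leq_exp2r // => ?; lia.
Qed.

(* The relations say that (mu - E) annihilates the vector X modulo P, and
   mu - E is invertible when mu is not an eigenvalue of E. *)
Lemma span_perturb (K : fieldType) (V : lmodType K) (P : V -> Prop) m
    (E : 'M[K]_m) (X : 'I_m -> V) mu :
  P 0 -> (forall x y, P x -> P y -> P (x + y)) -> (forall k x, P x -> P (k *: x)) ->
  ~~ root (char_poly E) mu ->
  (forall i, P (mu *: X i - \sum_j E i j *: X j)) -> forall i, P (X i).
Proof.
move=> P0 PD PZ; rewrite -eigenvalue_root_char negbK kermx_eq0 row_free_unit => Mu rel i.
pose M := E - mu%:M.
have PM k : P (\sum_j M k j *: X j).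
  have := PZ (-1) _ (rel k); congr P; rewrite scaleN1r opprB.
  rewrite [in RHS](eq_bigr (fun j => E k j *: X j - (mu *+ (k == j)) *: X j)); last first.
    by move=> j _; rewrite !mxE scalerBl.
  rewrite sumrB; congr (_ - _); rewrite (bigD1 k) //= eqxx mulr1n big1 ?addr0 //.
  by move=> j; rewrite eq_sym => /negbTE ->; rewrite mulr0n scale0r.
have -> : X i = \sum_k invmx M i k *: (\sum_j M k j *: X j).
  under eq_bigr do rewrite scaler_sumr.
  rewrite exchange_big /= (bigD1 i) //= [X in _ + X]big1 => [|j ji].
    rewrite addr0; under eq_bigr do rewrite scalerA.
    rewrite -scaler_suml; have : (invmx M *m M) i i = 1 by rewrite mulVmx // mxE eqxx.
    by rewrite mxE => ->; rewrite scale1r.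
  under eq_bigr do rewrite scalerA.
  rewrite -scaler_suml; have : (invmx M *m M) i j = 0.
    by rewrite mulVmx // mxE eq_sym (negbTE ji).
  by rewrite mxE => ->; rewrite scale0r.
by apply: big_ind => // k _; apply: PZ.
Qed.

(** * Monomials in three variables *)

Notation ix := (inord 0 : 'I_3).
Notation iy := (inord 1 : 'I_3).
Notation iz := (inord 2 : 'I_3).

Definition mono3 (i j k : nat) : 'X_{1..3} := [multinom nth 0%N [:: i; j; k] w | w < 3].

Lemma mono3x i j k : mono3 i j k ix = i. Proof. by rewrite mnmE inordK. Qed.
Lemma mono3y i j k : mono3 i j k iy = j. Proof. by rewrite mnmE inordK. Qed.
Lemma mono3z i j k : mono3 i j k iz = k. Proof. by rewrite mnmE inordK. Qed.
Definition mono3E := (mono3x, mono3y, mono3z).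

Lemma ord3P (w : 'I_3) : [\/ w = ix, w = iy | w = iz].
Proof.
case: w => [[|[|[|//]]] hw]; [apply: Or31 | apply: Or32 | apply: Or33];
  by apply: val_inj; rewrite /= inordK.
Qed.

Lemma sum3 (V : nmodType) (F : 'I_3 -> V) : \sum_w F w = F ix + F iy + F iz.
Proof.
rewrite !big_ord_recl big_ord0 addr0 addrA.
by congr (F _ + F _ + F _); apply: val_inj; rewrite /= inordK.
Qed.

Lemma mdeg3 (m : 'X_{1..3}) : mdeg m = (m ix + m iy + m iz)%N.
Proof. by rewrite mdegE; exact: (@sum3 nat). Qed.

Lemma mnm3P (m1 m2 : 'X_{1..3}) :
  m1 ix = m2 ix -> m1 iy = m2 iy -> m1 iz = m2 iz -> m1 = m2.
Proof. by move=> ex ey ez; apply/mnmP => w; case: (ord3P w) => ->. Qed.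

Lemma mono3_eta (m : 'X_{1..3}) : m = mono3 (m ix) (m iy) (m iz).
Proof. by apply: mnm3P; rewrite mono3E. Qed.

Lemma mono3D i j k i' j' k' :
  (mono3 i j k + mono3 i' j' k')%MM = mono3 (i + i') (j + j') (k + k').
Proof. by apply: mnm3P; rewrite mnmDE !mono3E. Qed.

Lemma vxyzX (K : fieldType) i j k :
  vx K ^+ i * vy K ^+ j * vz K ^+ k = 'X_[mono3 i j k].
Proof.
rewrite /vx /vy /vz !mpolyXn -!mpolyXD; congr 'X_[_].
by apply: mnm3P; rewrite !(mnmDE, mulmnE, mnm1E) mono3E -!val_eqE /= !inordK //=; lia.
Qed.

(** * Surjectivity for the degenerate algebra *)

Section Surjectivity.
Variables (K : fieldType) (a c u v d : nat).
Hypothesis char0 : [pchar K] =i pred0.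
Hypothesis (u_gt0 : (0 < u)%N) (lt_ua : (u < a)%N) (v_gt0 : (0 < v)%N) (lt_vc : (v < c)%N).
Hypothesis (d_gt0 : (0 < d)%N) (lt_db : (d < u + v)%N).

Let gI := gensI K a (u + v) c (u + v - d) v.
Let e := (a + c + d - 3)%N.

(** The monomial ideal of the four monomial generators of I, which in these parameters are x^a, z^c,
    x^(a-u) y^d and y^d z^(c-v). *)
Definition gens_mono : pred 'X_{1..3} := fun m =>
  [|| (a <= m ix)%N, (c <= m iz)%N | (d <= m iy)%N && ((a - u <= m ix) || (c - v <= m iz))%N].

Lemma gens_mono_in m : gens_mono m -> in_ideal gI 'X_[m].
Proof.
have gen j i : (j <= m)%MM -> gI i = 'X_[j] -> in_ideal gI 'X_[m].
  move=> le E; rewrite -(submK le) mpolyXD -E.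
  exact/in_idealM/in_ideal_gen.
have le3 i j k : (i <= m ix)%N -> (j <= m iy)%N -> (k <= m iz)%N -> (mono3 i j k <= m)%MM.
  by move=> ? ? ?; apply/mnm_lepP => w; case: (ord3P w) => ->; rewrite mono3E.
have E i j k : vx K ^+ i * vy K ^+ j * vz K ^+ k = 'X_[mono3 i j k] := vxyzX K i j k.
case/or3P => [h|h|/andP[h /orP[h'|h']]].
- apply: (gen (mono3 a 0 0) (inord 0)); first exact: le3.
  by rewrite /gI /gensI inordK //= -E !expr0 !mulr1.
- apply: (gen (mono3 0 0 c) (inord 2)); first exact: le3.
  by rewrite /gI /gensI inordK //= -E !expr0 !mul1r.
- apply: (gen (mono3 (a - u) d 0) (inord 3)); first exact: le3.
  rewrite /gI /gensI inordK //= -E expr0 mulr1; congr (_ ^+ _ * _ ^+ _); lia.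
- apply: (gen (mono3 0 d (c - v)) (inord 4)); first exact: le3.
  rewrite /gI /gensI inordK //= -E expr0 mul1r; congr (_ ^+ _ * _ ^+ _); lia.
Qed.

(** One rewriting step y^b -> x^u z^v with b = u + v; meaningful only for monomials divisible by
    y^b. *)
Definition shift (m : 'X_{1..3}) := mono3 (m ix + u) (m iy - (u + v)) (m iz + v).

Lemma shift_in (m : 'X_{1..3}) : (u + v <= m iy)%N -> in_ideal gI ('X_[m] - 'X_[shift m]).
Proof.
move=> h; have -> : 'X_[m] - 'X_[shift m] =
    'X_[mono3 (m ix) (m iy - (u + v)) (m iz)] * gI (inord 1).
  rewrite /gI /gensI inordK //= addnK mulrBr.
  have -> : vy K ^+ (u + v) = 'X_[mono3 0 (u + v) 0].
    by rewrite -vxyzX !expr0 mulr1 mul1r.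
  have -> : vx K ^+ u * vz K ^+ v = 'X_[mono3 u 0 v].
    by rewrite -vxyzX expr0 mulr1.
  rewrite -!mpolyXD !mono3D !addn0 subnK //; congr ('X_[_] - 'X_[_]).
  exact: mono3_eta.
exact/in_idealM/in_ideal_gen.
Qed.

Lemma mdeg_shift (m : 'X_{1..3}) : (u + v <= m iy)%N -> mdeg (shift m) = mdeg m.
Proof. by move=> h; rewrite !mdeg3 !mono3E; clear -h; lia. Qed.

Let L1 : {mpoly K[3]} := \sum_w 'X_w.

(** The degenerate ideal, with y^b in place of y^b - x^u z^v. *)
Definition degen_mono : pred 'X_{1..3} := fun m => gens_mono m || (u + v <= m iy)%N.

Definition degen_split N f := exists q h,
  [/\ q \is N.+1.-homog, h \is N.-homog, in_mono_ideal degen_mono q & f = q + L1 * h].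

Lemma degen_split0 N : degen_split N 0.
Proof.
by exists 0, 0; split; rewrite ?rpred0 ?mulr0 ?addr0 //; apply: in_mono_ideal0.
Qed.

Lemma degen_splitD N f1 f2 : degen_split N f1 -> degen_split N f2 -> degen_split N (f1 + f2).
Proof.
move=> [q1 [h1 [hq1 hh1 U1 ->]]] [q2 [h2 [hq2 hh2 U2 ->]]].
exists (q1 + q2), (h1 + h2); split; rewrite ?rpredD //; last by ring.
exact: in_mono_idealD.
Qed.

Lemma degen_splitZ N k f : degen_split N f -> degen_split N (k *: f).
Proof.
move=> [q [h [hq hh U ->]]]; exists (k *: q), (k *: h); split; rewrite ?rpredZ //.
  exact: in_mono_idealZ.
by rewrite scalerDr scalerAr.
Qed.

(* [ci_surj] for (x^a,y^d,z^c), then for (x^(a-u),y^(b-d),z^(c-v)) on the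
   remaining monomials, which are divisible by y^d. *)
Lemma degen_surj N f : (e < N.+1.*2)%N -> f \is N.+1.-homog -> degen_split N f.
Proof.
move=> hN hf; pose al w := nth 0%N [:: a; d; c] (w : 'I_3).
have [|| q [h [hq hh Uq ->]]] := ci_surj char0 (al := al) _ _ hf.
- by move=> w; case: (ord3P w) => ->; rewrite /al inordK //=; lia.
- by rewrite (@sum3 nat) /al !inordK //= /e; lia.
apply: degen_splitD; last first.
  exists 0, h; split; rewrite ?rpred0 ?add0r //.
  exact: in_mono_ideal0.
rewrite [q]mpolyE big_seq; apply: big_ind => [||m ms].
- exact: degen_split0.
- exact: degen_splitD.
apply: degen_splitZ; have dm := dhomog_mf hq ms.
have [gm|ngm] := boolP (gens_mono m).
  exists 'X_[m], 0; split; rewrite ?dhomogX ?rpred0 ?mulr0 ?addr0 //; first exact/eqP.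
  by apply: in_mono_idealX; rewrite /degen_mono gm.
have dy : (d <= m iy)%N.
  have /existsP[w] := Uq _ ms; move: ngm; rewrite /gens_mono.
  by case: (ord3P w) => ->; rewrite /al inordK //=; lia.
pose m' := mono3 (m ix) (m iy - d) (m iz).
have Em : m = (m' + mono3 0 d 0)%MM.
  by rewrite mono3D !addn0 subnK //; exact: mono3_eta.
(* Otherwise d = N + 1, and [hN] gives a + c - 3 < d, against d < u + v <= a + c - 2. Hence the
   cofactor of y^d has positive degree, as [ci_surj] requires. *)
have dN : (d <= N)%N by move: dm ngm; rewrite /= /gens_mono mdeg3; move: hN; rewrite /e; lia.
have hm' : ('X_[m'] : {mpoly K[3]}) \is (N - d).+1.-homog.
  by rewrite dhomogX /= mdeg3 !mono3E; move: dm; rewrite /= mdeg3; lia.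
pose al' w := nth 0%N [:: (a - u)%N; (u + v - d)%N; (c - v)%N] (w : 'I_3).
have [|| q' [h' [hq' hh' Uq' Eq']]] := ci_surj char0 (al := al') _ _ hm'.
- by move=> w; case: (ord3P w) => ->; rewrite /al' inordK //= subn_gt0.
(* The socle degree is now e - 2d. The shift by d that comes from y^d puts the center of symmetry
   back at e/2. *)
- rewrite (@sum3 nat) /al' !inordK //=; move: hN; rewrite /e; lia.
have hd : ('X_[mono3 0 d 0] : {mpoly K[3]}) \is d.-homog.
  by rewrite dhomogX /= mdeg3 !mono3E addn0.
exists (q' * 'X_[mono3 0 d 0]), (h' * 'X_[mono3 0 d 0]); split.
- by have := dhomogM hq' hd; rewrite addSn subnK.
- by have := dhomogM hh' hd; rewrite subnK.
(* Multiplication by y^d turns x^(a-u), y^(b-d), z^(c-v) into x^(a-u) y^d, y^b, y^d z^(c-v), all in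
   the degenerate ideal. *)
- move=> m2; rewrite (perm_mem (msuppMX _ _)) => /mapP[m3 /Uq' /existsP[w hw] ->].
  rewrite /degen_mono /gens_mono !mnmDE !mono3E.
  by move: hw; case: (ord3P w) => ->; rewrite /al' inordK //= => hw; clear -hw; lia.
by rewrite Em mpolyXD Eq' mulrDl mulrA.
Qed.

(** * Lifting surjectivity from the degeneration to R/I *)

Definition Llam (lam : K) : {mpoly K[3]} := lam *: 'X_ix + 'X_iy + lam *: 'X_iz.

(** The torus action behind the degeneration: it takes [L1] to [Llam lam], fixes y^b and multiplies
    x^u z^v by lam^b. *)
Definition rescale (lam : K) (f : {mpoly K[3]}) : {mpoly K[3]} :=
  f \mPo [tuple of [:: lam *: 'X_ix; 'X_iy; lam *: 'X_iz]].

Definition xzdeg (m : 'X_{1..3}) := (m ix + m iz)%N.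

Lemma rescaleX lam m : rescale lam 'X_[m] = lam ^+ xzdeg m *: 'X_[m].
Proof.
rewrite /rescale comp_mpolyX.
have -> (F : 'I_3 -> {mpoly K[3]}) : \prod_w F w = F ix * F iy * F iz.
  rewrite !big_ord_recl big_ord0 mulr1 mulrA.
  by congr (F _ * F _ * F _); apply: val_inj; rewrite /= inordK.
rewrite !(tnth_nth 0) /= !inordK //= [m in RHS]mono3_eta -vxyzX !exprZn.
by rewrite /xzdeg !mono3E exprD -!mul_mpolyC mpolyCM /vx /vy /vz; ring.
Qed.

Lemma rescale_sum lam (I : Type) (s : seq I) (k : I -> K) (F : I -> {mpoly K[3]}) :
  rescale lam (\sum_(i <- s) k i *: F i) = \sum_(i <- s) k i *: rescale lam (F i).
Proof.
by rewrite /rescale raddf_sum; apply: eq_bigr => i _; rewrite /= comp_mpolyZ.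
Qed.

Lemma rescaleE lam f :
  rescale lam f = \sum_(m <- msupp f) f@_m *: (lam ^+ xzdeg m *: 'X_[m]).
Proof.
by rewrite {1}[f]mpolyE rescale_sum; under eq_bigr do rewrite rescaleX.
Qed.

Lemma rescaleL lam : rescale lam L1 = Llam lam.
Proof.
rewrite /L1 sum3 /rescale !comp_mpolyD -!/(rescale _ _) !rescaleX /xzdeg.
by rewrite !mnm1E -!val_eqE /= !inordK //= !scale1r expr1.
Qed.

Lemma rescale_dhomog lam N f : f \is N.-homog -> rescale lam f \is N.-homog.
Proof.
move=> hf; rewrite rescaleE big_seq; apply: rpred_sum => m ms.
by rewrite !rpredZ // dhomogX /=; apply/eqP/(dhomog_mf hf ms).
Qed.

(* [r] is what is left of ['X_[m]] after reducing modulo the ideal: the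
   rescaling turns the relation y^b = x^u z^v into lam^b y^b = x^u z^v. *)
Lemma rescaled_relation N m : (e < N.+1.*2)%N -> mdeg m = N.+1 ->
  exists2 r, r \is N.+1.-homog & forall lam, in_ideal_plus gI (Llam lam) N
    (lam ^+ (u + v) *: rescale lam 'X_[m] - rescale lam r).
Proof.
move=> hN hm; have hX : ('X_[m] : {mpoly K[3]}) \is N.+1.-homog by rewrite dhomogX; apply/eqP.
have [q [h [hq hh Uq ->]]] := degen_surj hN hX.
(* Monomials of I reduce to 0 and the others, divisible by y^b, are rewritten once. The splitting
   involves only [L1], so [r] is independent of lam. *)
pose red m' : {mpoly K[3]} := if gens_mono m' then 0 else 'X_[shift m'].
exists (\sum_(m' <- msupp q) q@_m' *: red m').
  rewrite big_seq; apply: rpred_sum => m' ms'; rewrite rpredZ // /red.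
  case: ifP => [_|ng]; first exact: rpred0.
  have := Uq _ ms'; rewrite /degen_mono ng /= => /mdeg_shift dS.
  by rewrite dhomogX /= dS; apply/eqP/(dhomog_mf hq ms').
move=> lam; rewrite /rescale comp_mpolyD rmorphM /= -!/(rescale _ _) rescaleL.
rewrite scalerDr addrAC; apply: in_ideal_plusD; last first.
  by apply/in_ideal_plusZ/in_ideal_plus_mul/rescale_dhomog.
apply: in_ideal_plus_ideal; rewrite [rescale _ q]rescaleE scaler_sumr rescale_sum -sumrB /=.
apply: in_ideal_sum => m' ms'; rewrite scalerA mulrC -scalerA -scalerBr.
apply: in_idealZ; rewrite /red.
case: ifP => [gm|ng].
  by rewrite /rescale comp_mpoly0 subr0; do 2 apply: in_idealZ; apply: gens_mono_in.
have := Uq _ ms'; rewrite /degen_mono ng /= => hy.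
rewrite rescaleX scalerA -exprD.
have -> : xzdeg (shift m') = (u + v + xzdeg m')%N by rewrite /xzdeg !mono3E; lia.
by rewrite -scalerBr; apply/in_idealZ/shift_in.
Qed.

Lemma surj_at N : (e < N.+1.*2)%N -> exists lam : K,
  forall m, mdeg m = N.+1 -> in_ideal_plus gI (Llam lam) N 'X_[m].
Proof.
move=> hN; pose T : finType := {m : 'X_{1..3 < N.+2} | mdeg m == N.+1}.
have /fin_all_exists[r hr] : forall t : T, exists r : {mpoly K[3]},
    r \is N.+1.-homog /\ forall lam, in_ideal_plus gI (Llam lam) N
      (lam ^+ (u + v) *: rescale lam 'X_[val (val t)] - rescale lam r).
  move=> t; by have [r hr1 hr2] := rescaled_relation hN (eqP (valP t)); exists r.
pose mT (i : 'I_#|T|) : 'X_{1..3} := val (val (enum_val i)).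
have mT_ex m : mdeg m = N.+1 -> exists i, mT i = m.
  move=> hm; have h1 : (mdeg m < N.+2)%N by rewrite hm.
  have h2 : mdeg (BMultinom h1) == N.+1 by rewrite /= hm.
  exists (enum_rank (exist _ (BMultinom h1) h2 : T)).
  by rewrite /mT enum_rankK.
have mT_inj : injective mT by move=> i j /val_inj/val_inj/enum_val_inj.
have expand (f : {mpoly K[3]}) : f \is N.+1.-homog -> f = \sum_i f@_(mT i) *: 'X_[mT i].
  move=> hf; apply/mpolyP => m; rewrite raddf_sum /=.
  have [hm|hm] := eqVneq (mdeg m) N.+1.
    have [i <-] := mT_ex _ hm; rewrite (bigD1 i) //= mcoeffZ mcoeffX eqxx mulr1.
    rewrite big1 ?addr0 // => j ji; rewrite mcoeffZ mcoeffX.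
    by rewrite (inj_eq mT_inj) (negbTE ji) mulr0.
  rewrite (dhomog_nemf_coeff hf hm) big1 // => i _.
  rewrite mcoeffZ mcoeffX; case: eqP => [E|_]; last by rewrite mulr0.
  by case/eqP: hm; rewrite -E; apply/eqP/(valP (enum_val i)).
(* A matrix independent of lam. With mu = lam^b, the relations say that mu - E kills the vector of
   rescaled monomials modulo I + L [R]_N. *)
pose E := \matrix_(i, j) (r (enum_val i))@_(mT j) : 'M[K]_#|T|.
have b0 : (0 < u + v)%N by lia.
have [k k0 nr] := nat_power_nonroot char0 (monic_neq0 (char_poly_monic E)) b0.
exists k%:R => m /mT_ex[i <-].
(* A nonzero lam allows the rescaling factor of each monomial to be cancelled at the end. *)
have k0' : (k%:R : K) != 0 by have /pcharf0P -> := char0; lia.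
pose P := in_ideal_plus gI (Llam k%:R) N.
have : P (rescale k%:R 'X_[mT i]).
  apply: (span_perturb (P := P) (X := fun i => rescale k%:R 'X_[mT i]) _ _ _ nr).
  - exact/in_ideal_plus_ideal/in_ideal0.
  - by move=> *; apply: in_ideal_plusD.
  - by move=> *; apply: in_ideal_plusZ.
  move=> j; have [hrj /(_ k%:R)] := hr (enum_val j); rewrite natrX; congr P.
  congr (_ - _); rewrite {1}(expand _ hrj) rescale_sum; apply: eq_bigr => l _.
  by rewrite mxE.
rewrite rescaleX => /(in_ideal_plusZ (k%:R ^+ xzdeg (mT i))^-1).
by rewrite scalerA mulVf ?scale1r // expf_neq0.
Qed.

End Surjectivity.

(** * The Macaulay dual generator and its functional *)

Section Duality.
Variables (K : fieldType) (a c u v d : nat).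
Hypothesis char0 : [pchar K] =i pred0.
Hypothesis (u_gt0 : (0 < u)%N) (lt_ua : (u < a)%N) (v_gt0 : (0 < v)%N) (lt_vc : (v < c)%N).
Hypothesis (d_gt0 : (0 < d)%N) (lt_db : (d < u + v)%N).

Let gI := gensI K a (u + v) c (u + v - d) v.
Let e := (a + c + d - 3)%N.

(* The monomials of the Macaulay dual generator of I; the subtractions are
   genuine only when [in_dual k] holds. *)
Definition dual_mono k := mono3 (a - 1 - k * u) (d - 1 + k * (u + v)) (c - 1 - k * v).
Definition in_dual k := (k * u < a)%N && (k * v < c)%N.

(** The support of the dual generator. The range ['I_a] omits nothing, because u > 0 and k u < a
    force k < a. *)
Definition chi (m : 'X_{1..3}) := [exists k : 'I_a, in_dual k && (m == dual_mono k)].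

Lemma chiP m : reflect (exists2 k, in_dual k & m = dual_mono k) (chi m).
Proof.
apply: (iffP existsP) => [[k /andP[h /eqP E]]|[k h E]]; first by exists k.
have ka : (k < a)%N by move: h; rewrite /in_dual; nia.
by exists (Ordinal ka); rewrite /= h E eqxx.
Qed.

Lemma dual_mono_inj : injective dual_mono.
Proof.
move=> k l /(congr1 (fun m : 'X_{1..3} => m iy)); rewrite !mono3E => /addnI /eqP.
by rewrite eqn_mul2r => /orP[|/eqP //]; lia.
Qed.

(** The constant term of the contraction of the dual generator by f; it induces the Gorenstein
    pairing of f and g as phi (f g). *)
Definition phi (f : {mpoly K[3]}) : K := \sum_(k < a | in_dual k) f@_(dual_mono k).

Lemma phiD f1 f2 : phi (f1 + f2) = phi f1 + phi f2.
Proof. by rewrite /phi -big_split; apply: eq_bigr => k _; rewrite mcoeffD. Qed.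

Lemma phiZ x f : phi (x *: f) = x * phi f.
Proof. by rewrite /phi mulr_sumr; apply: eq_bigr => k _; rewrite mcoeffZ. Qed.

Lemma phiB f1 f2 : phi (f1 - f2) = phi f1 - phi f2.
Proof. by rewrite -scaleN1r phiD phiZ mulN1r. Qed.

Lemma phi_sum (I : Type) (r : seq I) (F : I -> {mpoly K[3]}) :
  phi (\sum_(i <- r) F i) = \sum_(i <- r) phi (F i).
Proof.
apply: (big_morph phi phiD); rewrite /phi big1 // => k _; exact: mcoeff0.
Qed.

Lemma phiX m : phi 'X_[m] = (chi m)%:R.
Proof.
rewrite /phi /chi; case: (boolP [exists k, _]) => [/existsP[k /andP[h /eqP ->]]|/existsPn nc].
  rewrite (bigD1 k) //= mcoeffX eqxx big1 ?addr0 // => l /andP[_ lk].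
  rewrite mcoeffX; case: eqP => // /dual_mono_inj /val_inj E.
  by rewrite E eqxx in lk.
rewrite big1 // => k hk; rewrite mcoeffX; case: eqP => // E.
by have := nc k; rewrite hk E eqxx.
Qed.

(** For k = 0 the exponents of x, y, z stay below a, d, c. For k >= 1 those of x and z stay below a
    - u and c - v. *)
Lemma chi_gens_mono m : gens_mono a c u v d m -> chi m = false.
Proof.
move=> gm; apply/negbTE/negP => /chiP[k /andP[hu hv] E]; move: gm.
rewrite /gens_mono E !mono3E; case: k {E} hu hv => [|k]; rewrite ?mulSn; lia.
Qed.

(** [shift] takes [dual_mono k.+1] to [dual_mono k], while [dual_mono 0] is not divisible by y^b,
    its y-exponent being d - 1. *)
Lemma chi_shift (m : 'X_{1..3}) : (u + v <= m iy)%N -> chi (shift u v m) = chi m.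
Proof.
move=> hy; apply/chiP/chiP => -[k /andP[hu hv] E].
  have Ex := congr1 (fun m : 'X_{1..3} => m ix) E.
  have Ey := congr1 (fun m : 'X_{1..3} => m iy) E.
  have Ez := congr1 (fun m : 'X_{1..3} => m iz) E.
  rewrite !mono3E in Ex Ey Ez.
  exists k.+1; first by rewrite /in_dual !mulSn; lia.
  by apply: mnm3P; rewrite !mono3E !mulSn; lia.
move: hy hu hv; rewrite E mono3E; case: k {E} => [|k]; first by rewrite mul0n; lia.
rewrite !mulSn => hy hu hv; exists k; first by rewrite /in_dual; lia.
by rewrite /shift !mono3E; apply: mnm3P; rewrite !mono3E !mulSn; lia.
Qed.

Lemma phi_ideal f : in_ideal gI f -> phi f = 0.
Proof.
move=> [h ->]; rewrite phi_sum big1 // => j _.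
rewrite [h j]mpolyE mulr_suml phi_sum big1 // => m _.
rewrite -scalerAl phiZ; suff -> : phi ('X_[m] * gI j) = 0 by rewrite mulr0.
have mono m' : gI j = 'X_[m'] -> gens_mono a c u v d (m + m')%MM -> phi ('X_[m] * gI j) = 0.
  by move=> -> gm; rewrite -mpolyXD phiX chi_gens_mono.
case: j mono => [[|[|[|[|[|//]]]]] hj]; rewrite /gI /gensI /= => mono.
- apply: (mono (mono3 a 0 0)); first by rewrite -vxyzX !expr0 !mulr1.
  by rewrite /gens_mono !mnmDE !mono3E; lia.
- rewrite addnK.
  have -> : vy K ^+ (u + v) = 'X_[mono3 0 (u + v) 0].
    by rewrite -vxyzX !expr0 mulr1 mul1r.
  have -> : vx K ^+ u * vz K ^+ v = 'X_[mono3 u 0 v].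
    by rewrite -vxyzX expr0 mulr1.
  rewrite mulrBr -!mpolyXD phiB !phiX.
  have -> : (m + mono3 u 0 v)%MM = shift u v (m + mono3 0 (u + v) 0).
    by apply: mnm3P; rewrite /shift !(mono3E, mnmDE); lia.
  by rewrite chi_shift ?subrr // mnmDE mono3E; lia.
- apply: (mono (mono3 0 0 c)); first by rewrite -vxyzX !expr0 !mul1r.
  by rewrite /gens_mono !mnmDE !mono3E; lia.
- have E1 : (a + v - (u + v) = a - u)%N by lia.
  have E2 : (u + v - (u + v - d) = d)%N by lia.
  apply: (mono (mono3 (a - u) d 0)); first by rewrite -vxyzX E1 E2 expr0 mulr1.
  by rewrite /gens_mono !mnmDE !mono3E; lia.
- have E2 : (u + v - (u + v - d) = d)%N by lia.
  apply: (mono (mono3 0 d (c - v))); first by rewrite -vxyzX E2 expr0 mul1r.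
  by rewrite /gens_mono !mnmDE !mono3E; lia.
Qed.

(** * Standard monomials and the perfect pairing *)

Definition normal : pred 'X_{1..3} := predC (degen_mono a c u v d).

(** Each rewriting step y^b -> x^u z^v lowers the y-exponent, so the reduction ends. *)
Lemma normal_formX m : exists2 f : {mpoly K[3]}, f \is (mdeg m).-homog &
  in_mono_ideal normal f /\ in_ideal gI ('X_[m] - f).
Proof.
have [n] := ubnP (m iy); elim: n m => // n IH m; rewrite ltnS => hn.
have [gm|ngm] := boolP (gens_mono a c u v d m).
  exists 0; first exact: rpred0.
  by split; [exact: in_mono_ideal0 | rewrite subr0; apply: gens_mono_in].
have [hy|hy] := leqP (u + v) (m iy).
  have [|f hf [nf If]] := IH (shift u v m); first by rewrite mono3E; lia.
  exists f; first by rewrite -(mdeg_shift hy).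
  split=> //; have -> : 'X_[m] - f = ('X_[m] - 'X_[shift u v m]) + ('X_[shift u v m] - f).
    by ring.
  by apply: in_idealD => //; apply: shift_in.
exists 'X_[m]; first by rewrite dhomogX.
split; last by rewrite subrr; apply: in_ideal0.
by apply: in_mono_idealX; rewrite /normal /= /degen_mono negb_or ngm -ltnNge.
Qed.

Lemma normal_form N f : f \is N.-homog -> exists2 f' : {mpoly K[3]}, f' \is N.-homog &
  in_mono_ideal normal f' /\ in_ideal gI (f - f').
Proof.
move=> hf; rewrite [f]mpolyE big_seq.
pose P g := exists2 f' : {mpoly K[3]}, f' \is N.-homog &
  in_mono_ideal normal f' /\ in_ideal gI (g - f').
apply: (big_ind P) => [|f1 f2|m ms].
- exists 0; first exact: rpred0.
  by split; [exact: in_mono_ideal0 | rewrite subrr; apply: in_ideal0].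
- move=> [g1 h1 [n1 i1]] [g2 h2 [n2 i2]]; exists (g1 + g2); first exact: rpredD.
  split; last by have := in_idealD i1 i2; congr in_ideal; ring.
  exact: in_mono_idealD.
have [g hg [ng ig]] := normal_formX m.
exists (f@_m *: g); first by rewrite rpredZ // -(dhomog_mf hf ms).
split; first exact: in_mono_idealZ.
by rewrite -scalerBr; apply: in_idealZ.
Qed.

(** For normal m, the product of m and [compl m] is [dual_mono 0] when y^d does not divide m, and
    [dual_mono 1] when it does. These are the socle monomials of the two pieces of the
    degeneration. *)
Definition compl (m : 'X_{1..3}) :=
  if (m iy < d)%N then mono3 (a - 1 - m ix) (d - 1 - m iy) (c - 1 - m iz)
  else mono3 (a - u - 1 - m ix) (u + v + d - 1 - m iy) (c - v - 1 - m iz).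

Lemma mdeg_compl m : normal m -> (mdeg m + mdeg (compl m))%N = e.
Proof.
rewrite /normal /compl /= /degen_mono /gens_mono !mdeg3 /e.
by case: ltnP; rewrite !mono3E; lia.
Qed.

Lemma normalP m : normal m -> [/\ (m ix < a)%N, (m iz < c)%N, (m iy < u + v)%N &
  (d <= m iy)%N -> (m ix < a - u)%N /\ (m iz < c - v)%N].
Proof.
rewrite /normal /= /degen_mono /gens_mono !negb_or negb_and negb_or -!ltnNge.
by case/andP=> /and3P[xa zc low] yb; split=> // dy; move: low; rewrite ltnNge dy => /andP.
Qed.

(** The y-exponents of m and m' are both below b, so comparing y-exponents leaves only k = 0 or k =
    1, according to the case in [compl]; then m' = m. Thus the pairing matrix is the identity. *)
Lemma chi_compl m m' : normal m -> normal m' -> chi (m' + compl m)%MM = (m' == m).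
Proof.
move=> /normalP[xa zc yb low] /normalP[_ _ yb' _].
apply/chiP/eqP => [[k _ E]|->].
  have Ex := congr1 (fun m : 'X_{1..3} => m ix) E.
  have Ey := congr1 (fun m : 'X_{1..3} => m iy) E.
  have Ez := congr1 (fun m : 'X_{1..3} => m iz) E.
  move: Ex Ey Ez; rewrite !mnmDE /compl; case: ltnP => [hy|/[dup] hy /low[xp zq]].
    rewrite !mono3E; case: k {E} => [|k]; rewrite ?mul0n ?mulSn => Ex Ey Ez.
      by apply: mnm3P; [clear -Ex xa | clear -Ey hy | clear -Ez zc]; lia.
    by exfalso; clear -Ey yb' hy; lia.
  rewrite !mono3E; case: k {E} => [|[|k]]; rewrite ?mul0n ?mul1n ?mulSn => Ex Ey Ez.
  - by exfalso; clear -Ey yb d_gt0; lia.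
  - by apply: mnm3P; [clear -Ex xp | clear -Ey yb hy d_gt0 | clear -Ez zq]; lia.
  - by exfalso; clear -Ey yb' hy d_gt0; lia.
rewrite /compl; case: ltnP => [hy|/[dup] hy /low[xp zq]].
  exists 0%N; first by rewrite /in_dual !mul0n; clear -lt_ua lt_vc; lia.
  by apply: mnm3P; rewrite mnmDE !mono3E ?mul0n; [clear -xa | clear -hy | clear -zc]; lia.
exists 1%N; first by rewrite /in_dual !mul1n lt_ua.
apply: mnm3P; rewrite mnmDE !mono3E ?mul1n.
- by clear -xp; lia.
- by clear -yb d_gt0; lia.
- by clear -zq; lia.
Qed.

(* phi (f g) is a perfect pairing on R/I, so injectivity of L from degree i is
   dual to surjectivity of L onto degree e - i. *)
Lemma inj_of_surj L i N : (i + N.+1)%N = e ->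
  (forall m, mdeg m = N.+1 -> in_ideal_plus gI L N 'X_[m]) -> mulL_injective gI L i.
Proof.
move=> ei surj f hf ILf; have hf' : f \is i.-homog by apply/dhomogP.
have [g hg [ng Ig]] := normal_form hf'.
suff g0 : g = 0 by rewrite g0 subr0 in Ig.
apply/mpolyP => m; rewrite mcoeff0; apply/eqP; rewrite mcoeff_eq0; apply/negP => ms.
have nm := ng _ ms; have dm := dhomog_mf hg ms.
(* Modulo I, g times [compl m] becomes f L h, which is 0 because L f lies in I. By [chi_compl], phi
   of that product is the coefficient of g at m. *)
have [h hh Ih] : in_ideal_plus gI L N 'X_[compl m].
  by apply: surj; have := mdeg_compl nm; rewrite /= in dm; lia.
have : phi (g * 'X_[compl m]) = 0.
  apply: phi_ideal.
  have -> : g * 'X_[compl m] =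
      h * (L * f) + f * ('X_[compl m] - L * h) - 'X_[compl m] * (f - g) by ring.
  by apply: in_idealB; [apply: in_idealD|]; apply: in_idealM.
have -> : phi (g * 'X_[compl m]) = g@_m.
  rewrite [g in LHS]mpolyE mulr_suml phi_sum (bigD1_seq m) //= big_seq_cond big1.
    by rewrite -scalerAl phiZ -mpolyXD phiX chi_compl // eqxx mulr1 addr0.
  move=> m' /andP[ms' mm']; rewrite -scalerAl phiZ -mpolyXD phiX chi_compl //.
    by rewrite (negbTE mm') mulr0.
  exact: ng.
by move/eqP; apply/negP; rewrite -mcoeff_msupp.
Qed.

Lemma WLP_gensI : has_WLP gI.
Proof.
have [lam surj0] : exists lam : K,
    forall m, mdeg m = (e./2).+1 -> in_ideal_plus gI (Llam lam) e./2 'X_[m].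
  by apply: surj_at => //; rewrite -/e; lia.
have surj := in_ideal_plus_above surj0.
exists (Llam lam) => [|i].
  by apply/dhomogP; rewrite !(rpredD, rpredZ) // dhomogX /= mdeg1.
(* From floor(e/2) on, L is surjective. Below it, e - i - 1 >= floor(e/2), and surjectivity onto
   degree e - i dualizes to injectivity in degree i. *)
have [hi|hi] := leqP e./2 i.
  right=> f /dhomogP hf.
  suff [h /dhomogP hh Ih] : in_ideal_plus gI (Llam lam) i f by exists h.
  rewrite [f]mpolyE; apply: in_ideal_plus_sum => m ms; apply: in_ideal_plusZ.
  by have := @surj (i - e./2)%N m; rewrite subnK //; apply; apply: (dhomog_mf hf ms).
left; have := @surj (e - i - 1 - e./2)%N; rewrite subnK; last by lia.
by apply: inj_of_surj; lia.
Qed.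

End Duality.

Theorem theorem5p3 (K : fieldType) (a b c beta gamma : nat) :
  [pchar K] =i pred0 ->
  (c <= a)%N -> (2 <= c)%N ->
  (1 <= beta)%N -> (beta <= b - 1)%N ->
  (maxn 1 (b - a + 1) <= gamma)%N -> (gamma <= minn (b - 1) (c - 1))%N ->
  (a = 5 \/ b = 5 \/ c = 5)%N ->
  has_WLP (gensI K a b c beta gamma).
Proof.
move=> char0 le_ca c2 beta1 le_beta le_gamma gamma_le _.
have Eb : (b - gamma + gamma = b)%N by lia.
have Ebeta : (b - (b - beta) = beta)%N by lia.
(* The bounds on gamma amount to 0 < u < a and 0 < v < c, those on beta to 0 < d < b. *)
have := @WLP_gensI K a c (b - gamma) gamma (b - beta) char0; rewrite Eb Ebeta.
by apply; lia.
Qed.
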